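(* Let $W=(w_1,\ldots,w_N)$ be a system of contracting similitudes in $\mathbb R^d$, $d\in\mathbb N$, $N\geq 2$, such that $\dim A(W)=\alpha(W)$. Then $W$ satisfies the strong Markov property (SMP).
   Context: $\mathbb N=\{1,2,\ldots\}$. A mapping $w:\mathbb R^d\to\mathbb R^d$ is a contracting similitude if there is $r\in(0,1)$ (its similarity coefficient) with $|w(x)-w(y)|=r|x-y|$ for all $x,y\in\mathbb R^d$ (Euclidean distance). For a system $W=(w_1,\ldots,w_N)$ of contracting similitudes with similarity coefficients $r_1,\ldots,r_N$, $A=A(W)$ is its attractor, i.e. the unique non-empty compact set with $A=\bigcup_{i=1}^N w_i(A)$; $\alpha(W)$, the similarity dimension, is the unique positive number with $r_1^{\alpha(W)}+\cdots+r_N^{\alpha(W)}=1$; and $\dim A$ is the Hausdorff dimension of $A$. Let $\Sigma=\{1,\ldots,N\}$ and $w_{\mathbf i}=w_{i_1}\circ\cdots\circ w_{i_n}$ for $\mathbf i=(i_1,\ldots,i_n)\in\Sigma^n$. The system $W$ satisfies the strong Markov property (SMP) if for every $n\in\mathbb N$ there is an open set $\mathcal O_n\subset\mathbb R^d$ such that (1) $\overline{\mathcal O_n\cap A}=A$; and (2) $w_{\mathbf i}(\mathcal O_n)\cap w_{\mathbf j}(\mathcal O_n)=\emptyset$ for all $\mathbf i\neq\mathbf j\in\Sigma^n$. *)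

(* Defs.v *)
From HB Require Import structures.
From mathcomp Require Import all_boot all_order all_algebra.
From mathcomp Require Import all_classical all_reals all_analysis.

Set Implicit Arguments.
Unset Strict Implicit.
Unset Printing Implicit Defensive.

Import Order.TTheory GRing.Theory Num.Theory.
Import numFieldNormedType.Exports.

Local Open Scope classical_set_scope.
Local Open Scope ring_scope.

(* Points of R^d are row vectors.  The library metric on matrices is the
   sup metric, so distances and diameters are computed from the Euclidean
   distance below; [open], [closure] and [compact] refer to the library
   topology on 'rV[R]_d, which the Euclidean distance also induces. *)
Definition eucl_dist (R : realType) (d : nat) (x y : 'rV[R]_d) : R :=
  Num.sqrt (\sum_(k < d) (x ord0 k - y ord0 k) ^+ 2).

Section Hausdorff.
Variables (R : realType) (d : nat).
Implicit Types (U A : set 'rV[R]_d) (s delta : R).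
Local Open Scope ereal_scope.

(* The diameter of the empty set is -oo here; it never enters a sum, see
   [diam_pow]. *)
Definition eucl_diam U : \bar R :=
  ereal_sup [set (eucl_dist x y)%:E | x in U & y in U].

(* diam(U)^s with diam(set0)^s = 0 for every s >= 0; for nonempty U and
   s = 0 the value is 1, so that the 0-dimensional measure counts points. *)
Definition diam_pow s U : \bar R :=
  if U == set0 then 0 else poweR (eucl_diam U) s.

(* Covers are sequences of arbitrary sets; finite covers are included, being
   padded with set0. *)
Definition hausdorff_premeasure s delta A : \bar R :=
  ereal_inf [set \sum_(0 <= k <oo) diam_pow s (U k) |
    U in [set U : nat -> set 'rV[R]_d |
      (forall k, eucl_diam (U k) <= delta%:E) /\ A `<=` \bigcup_k U k]].

Definition hausdorff_measure s A : \bar R :=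
  ereal_sup [set hausdorff_premeasure s delta A |
    delta in [set delta : R | (0 < delta)%R]].

Definition hausdorff_dim A : \bar R :=
  ereal_inf [set s%:E | s in
    [set s : R | (0 <= s)%R /\ hausdorff_measure s A = 0]].

End Hausdorff.

Definition contracting_similitude (R : realType) (d : nat) (r : R)
    (f : 'rV[R]_d -> 'rV[R]_d) : Prop :=
  [/\ 0 < r, r < 1 & forall x y, eucl_dist (f x) (f y) = r * eucl_dist x y].

(* The set so characterised exists and is unique for every nonempty finite
   system of contracting similitudes. *)
Definition is_attractor (R : realType) (d N : nat)
    (w : 'I_N -> 'rV[R]_d -> 'rV[R]_d) (A : set 'rV[R]_d) : Prop :=
  [/\ A !=set0, compact A & A = \bigcup_(i in [set: 'I_N]) (w i @` A)].

(* The number so characterised exists and is unique when N >= 2 and every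
   r i lies in ]0, 1[. *)
Definition is_similarity_dim (R : realType) (N : nat) (r : 'I_N -> R)
    (alpha : R) : Prop :=
  0 < alpha /\ \sum_(i < N) r i `^ alpha = 1.

(* For a word i1 ... in this is w i1 \o ... \o w in. *)
Definition word_map (R : realType) (d N : nat)
    (w : 'I_N -> 'rV[R]_d -> 'rV[R]_d) (s : seq 'I_N) : 'rV[R]_d -> 'rV[R]_d :=
  foldr (fun k g => w k \o g) id s.

(* [A] is meant to be the attractor of [w]. *)
Definition strong_markov_property (R : realType) (d N : nat)
    (w : 'I_N -> 'rV[R]_d -> 'rV[R]_d) (A : set 'rV[R]_d) : Prop :=
  forall n : nat, (0 < n)%N -> exists O : set 'rV[R]_d,
    [/\ open O, closure (O `&` A) = A &
        forall i j : n.-tuple 'I_N, i <> j ->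
          (word_map w i @` O) `&` (word_map w j @` O) = set0].

(* Main.v *)
Require Import Defs.
From HB Require Import structures.
From mathcomp Require Import all_boot all_order all_algebra.
From mathcomp Require Import all_classical all_reals all_analysis.
From mathcomp Require Import lra.
Import Order.TTheory GRing.Theory Num.Theory.
Import numFieldNormedType.Exports.
Local Open Scope classical_set_scope.
Local Open Scope ring_scope.

(** Fix [n] and abbreviate [word_map w i] to [w_i].  Call a point [x] of the
attractor good when [w_i x] lies outside [w_j A] for all distinct words [i], [j]
of length [n].

The equality of dimensions makes the good points dense in [A].  The bad points
are the finite union of the closed sets [C i j], the preimages of [w_j A] under
[w_i], so it suffices that no [C i j] contains a nonempty relatively open part
of [A] ([avoid_closed_family]).  Such a part contains a small copy [w_s A]
([open_contains_word_image]), and if [w_s A] is inside [C i j] then [w_(i ++ s)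
A] is inside [w_j A].  Expanding [w_j A] into its copies of the level of [i ++
s], one sees that the single word [i ++ s] can be removed from that level: the
remaining words still cover [A].  But the [alpha]-powers of their ratios add up
to less than [1], hence so do the [beta]-powers for some [beta < alpha]
([sum_powR_lt1]).  Iterating the cover then produces arbitrarily fine covers
with arbitrarily small [beta]-sums ([self_covered_hausdorff_measure0]), whence
[dim A <= beta < alpha] ([redundant_word_dim_lt]), a contradiction
([word_image_not_sub]).

To pass from good points to an open set, surround each good point [x] by a ball
whose radius [e] satisfies [2 r_i e <= dist (w_i x) (w_j A)] for all [j <> i].
The union [O] of these balls is open and [O `&` A] is dense in [A].  If [w_i O]
met [w_j O] at [z], coming from balls of radii [e] and [f] around [x] and [y],
then [w_i x] and [w_j y] would be at distance less than
[2 max (r_i e) (r_j f)] by way of [z], against the choice of one of the two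
radii. *)

Set Implicit Arguments.
Unset Strict Implicit.
Unset Printing Implicit Defensive.

(** * Euclidean distance *)

Section EuclideanDistance.
Context {R : realType} {d : nat}.
Implicit Types (x y z a : 'rV[R]_d) (A V : set 'rV[R]_d).

Lemma eucl_dist_ge0 x y : 0 <= eucl_dist x y.
Proof. exact: sqrtr_ge0. Qed.

Lemma eucl_dist_sym x y : eucl_dist x y = eucl_dist y x.
Proof.
by congr Num.sqrt; apply: eq_bigr => k _; rewrite -opprB sqrrN.
Qed.

Lemma eucl_distxx x : eucl_dist x x = 0.
Proof. by rewrite /eucl_dist big1 ?sqrtr0// => k _; rewrite subrr expr0n. Qed.

Lemma eucl_dist_sqr x y :
  eucl_dist x y ^+ 2 = \sum_(k < d) (x ord0 k - y ord0 k) ^+ 2.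
Proof. by rewrite sqr_sqrtr ?sumr_ge0// => k _; exact: sqr_ge0. Qed.

(** From [(a + b)^2 <= 2 a^2 + 2 b^2] in each coordinate.  This weak form
of the triangle inequality is enough to bound diameters and to separate
balls. *)
Lemma eucl_dist_max2 x y z :
  eucl_dist x z <= 2 * Num.max (eucl_dist x y) (eucl_dist y z).
Proof.
set m := Num.max _ _.
have xym : eucl_dist x y <= m by rewrite le_max lexx.
have yzm : eucl_dist y z <= m by rewrite le_max lexx orbT.
have m_ge0 : 0 <= m by exact: le_trans (eucl_dist_ge0 _ _) xym.
rewrite -(@ler_pXn2r _ 2) ?nnegrE ?mulr_ge0 ?eucl_dist_ge0//.
have : 2 * eucl_dist x y ^+ 2 + 2 * eucl_dist y z ^+ 2 <= (2 * m) ^+ 2.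
  have : eucl_dist x y ^+ 2 <= m ^+ 2.
    by rewrite ler_pXn2r ?nnegrE ?eucl_dist_ge0.
  have : eucl_dist y z ^+ 2 <= m ^+ 2.
    by rewrite ler_pXn2r ?nnegrE ?eucl_dist_ge0.
  rewrite exprMn; lra.
apply: le_trans; rewrite !eucl_dist_sqr !mulr_sumr -big_split/=.
apply: ler_sum => k _.
have := sqr_ge0 ((x ord0 k - y ord0 k) - (y ord0 k - z ord0 k)); nra.
Qed.

Lemma coord_le_eucl_dist x y (k : 'I_d) :
  `|x ord0 k - y ord0 k| <= eucl_dist x y.
Proof.
rewrite -(@ler_pXn2r _ 2) ?nnegrE ?eucl_dist_ge0// eucl_dist_sqr.
rewrite real_normK ?num_real// (bigD1 k)//= lerDl.
by apply: sumr_ge0 => i _; exact: sqr_ge0.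
Qed.

Lemma continuous_eucl_dist a : continuous (fun x : 'rV[R]_d => eucl_dist x a).
Proof.
move=> x.
pose S (y : 'rV[R]_d) := \sum_(k < d) (y ord0 k - a ord0 k) ^+ 2.
have sum_cvg : S @ x --> S x.
  apply: (cvg_big _ (nbhs_filter x)) => [|k _]; first exact: add_continuous.
  pose f (y : 'rV[R]_d) := y ord0 k - a ord0 k.
  have xk : f @ x --> f x.
    have ck : (fun y : 'rV[R]_d => y ord0 k) @ x --> x ord0 k.
      exact: coord_continuous.
    exact: (cvgB ck (cvg_cst _)).
  exact: (cvgM xk xk).
exact: (continuous_cvg _ (@sqrt_continuous _ _) sum_cvg).
Qed.

Lemma open_eucl_ball a e : open [set x | eucl_dist x a < e].
Proof.
have : open ((fun x => eucl_dist x a) @^-1` [set t : R | t < e]).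
  by apply: open_comp => [x _|]; [exact: continuous_eucl_dist | exact: open_lt].
exact.
Qed.

Lemma open_contains_eucl_ball V a : open V -> V a ->
  exists2 e, 0 < e & forall x, eucl_dist x a < e -> V x.
Proof.
move=> Vo Va; have /nbhs_ballP[e /= e0 eV] := open_nbhs_nbhs (conj Vo Va).
exists e => // x xa; apply: eV; split=> // i j; rewrite ord1 /ball/= distrC.
exact: le_lt_trans (coord_le_eucl_dist _ _ _) xa.
Qed.

Lemma compact_eucl_bounded A : compact A ->
  exists2 D, 0 <= D & forall x y, A x -> A y -> eucl_dist x y <= D.
Proof.
have [->|/set0P[a Aa] Ac] := eqVneq A set0; first by exists 0.
have /compact_bounded[M [_ bM]] : compact [set eucl_dist x a | x in A].
  apply: continuous_compact => //.
  exact/continuous_subspaceT/continuous_eucl_dist.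
have Ma x : A x -> eucl_dist x a <= M + 1.
  move=> Ax; rewrite -[leLHS]ger0_norm ?eucl_dist_ge0//.
  by apply: (bM (M + 1)); [rewrite ltrDl | exists x].
exists (2 * (M + 1)).
  by rewrite mulr_ge0// (le_trans _ (Ma _ Aa))// eucl_dist_ge0.
move=> x y Ax Ay; apply: le_trans (eucl_dist_max2 x a y) _.
by rewrite ler_wpM2l// ge_max Ma//= eucl_dist_sym Ma.
Qed.

End EuclideanDistance.

(** * Words *)

Section Words.
Context {R : realType} {d N : nat}.
Variables (w : 'I_N -> 'rV[R]_d -> 'rV[R]_d) (r : 'I_N -> R).
Implicit Types (s t : seq 'I_N) (A : set 'rV[R]_d).

Lemma word_map_cat s t : word_map w (s ++ t) = word_map w s \o word_map w t.
Proof. by elim: s => //= i s ->. Qed.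

Lemma word_map_sub A s :
  (forall i, w i @` A `<=` A) -> word_map w s @` A `<=` A.
Proof.
move=> wA; elim: s => [x [y Ay <-]//|i s IH x [y Ay <-]] /=.
by apply: (wA i); exists (word_map w s y) => //; apply: IH; exists y.
Qed.

Lemma word_cover A k : A `<=` \bigcup_(i in setT) (w i @` A) ->
  A `<=` \bigcup_(t in [set: k.-tuple 'I_N]) (word_map w t @` A).
Proof.
move=> Aw; elim: k => [|k IH] x Ax; first by exists [tuple] => //; exists x.
have [i _ [y Ay <-]] := Aw x Ax.
have [t _ [z Az <-]] := IH y Ay.
by exists [tuple of i :: t] => //; exists z.
Qed.

Hypothesis w_sim : forall i, contracting_similitude (r i) (w i).

Definition word_ratio s : R := \prod_(k <- s) r k.

Lemma word_ratio_gt0 s : 0 < word_ratio s.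
Proof. by apply: prodr_gt0 => i _; have [] := w_sim i. Qed.

Lemma word_ratio_lt1 s : (0 < size s)%N -> word_ratio s < 1.
Proof.
case: s => //= i s _; rewrite /word_ratio big_cons.
have [ri0 ri1 _] := w_sim i.
rewrite (le_lt_trans _ ri1)// ler_piMr ?(ltW ri0)//.
apply: Num.Theory.prodr_ile1 => j; have [? ? _] := w_sim j.
by rewrite !ltW.
Qed.

Lemma word_map_dist s x y :
  eucl_dist (word_map w s x) (word_map w s y) = word_ratio s * eucl_dist x y.
Proof.
rewrite /word_ratio; elim: s => [|i s IH] /=; first by rewrite big_nil mul1r.
by have [_ _ ->] := w_sim i; rewrite IH big_cons mulrA.
Qed.

Lemma word_map_similitude s : (0 < size s)%N ->
  contracting_similitude (word_ratio s) (word_map w s).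
Proof.
move=> s_gt0; split; [exact: word_ratio_gt0 | exact: word_ratio_lt1 |].
exact: word_map_dist.
Qed.

Lemma word_map_continuous s : continuous (word_map w s).
Proof.
move=> x; apply/(@cvg_ballP R 'rV[R]_d _ (nbhs x) (nbhs_filter x)
  (word_map w s) (word_map w s x)) => e e0.
have dist0 : (fun y : 'rV[R]_d => eucl_dist y x) @ x --> 0.
  by rewrite -(eucl_distxx x); exact: continuous_eucl_dist.
have := @cvgr_lt _ _ _ (nbhs_filter x) _ _ dist0 _
  (divr_gt0 e0 (word_ratio_gt0 s)).
apply: filterS => y; rewrite ltr_pdivlMr ?word_ratio_gt0// => yx.
split=> // i j; rewrite ord1 /ball/=.
apply: le_lt_trans (coord_le_eucl_dist _ _ _) _.
by rewrite word_map_dist eucl_dist_sym mulrC.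
Qed.

(** The ratio of a word of length [k] is at most [q ^+ k], where [q < 1] is the
largest ratio of the system. *)
Lemma word_ratio_small e : 0 < e ->
  \forall k \near \oo, forall t : k.-tuple 'I_N, word_ratio t < e.
Proof.
move=> e0; pose q := \big[Num.max/0]_i r i.
have q0 : 0 <= q by exact: bigmax_ge_id.
have q1 : `|q| < 1.
  by rewrite ger0_norm//; apply: bigmax_lt => // i _; have [] := w_sim i.
apply: filterS (cvgr_lt _ (cvg_expr q1) _ e0) => k /le_lt_trans qk t.
apply: qk; rewrite /word_ratio big_tuple -[k in q ^+ k]card_ord.
rewrite -prodr_const; apply: ler_prod => i _.
by have [/ltW-> _ _] := w_sim (tnth t i); exact: le_bigmax.
Qed.

End Words.

(** The multinomial expansion of the power, indexed by words: it makes the power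
sums of the ratios multiplicative in the length of words. *)
Lemma sum_tuple_prod {R : comNzRingType} {I : finType} (F : I -> R) k :
  \sum_(t : k.-tuple I) \prod_(i <- t) F i = (\sum_i F i) ^+ k.
Proof.
rewrite -[k in RHS]card_ord -prodr_const bigA_distr_bigA/=.
under eq_bigr do rewrite big_tuple.
rewrite (reindex (fun f : {ffun 'I_k -> I} => [tuple f i | i < k]))/=.
  by apply: eq_bigr => f _; apply: eq_bigr => i _; rewrite tnth_mktuple.
exists (fun t : k.-tuple I => [ffun i => tnth t i]) => [f _|t _].
  by apply/ffunP => i; rewrite ffunE tnth_mktuple.
by apply: eq_from_tnth => i; rewrite tnth_mktuple ffunE.
Qed.

Lemma powR_prod {R : realType} {I : Type} (s : seq I) (F : I -> R) (a : R) :
  (forall i, 0 <= F i) -> (\prod_(i <- s) F i) `^ a = \prod_(i <- s) F i `^ a.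
Proof.
move=> F0; elim: s => [|i s IH]; first by rewrite !big_nil powR1.
by rewrite !big_cons powRM ?IH// prodr_ge0.
Qed.

(** A finite sum of powers depends continuously on the exponent, so a strict
inequality survives a small decrease of the exponent. *)
Lemma sum_powR_lt1 {R : realType} {I : finType} (P : pred I) (F : I -> R)
    (a : R) :
  0 < a -> (forall i, 0 < F i) -> \sum_(i | P i) F i `^ a < 1 ->
  exists s, [/\ 0 < s, s < a & \sum_(i | P i) F i `^ s < 1].
Proof.
move=> a0 F0 Fa.
have Fcvg : (fun s : R => \sum_(i | P i) F i `^ s) @ a -->
    \sum_(i | P i) F i `^ a.
  apply: (cvg_big _ (nbhs_filter a)) => [|i _]; first exact: add_continuous.
  rewrite /powR gt_eqF//; apply: continuous_comp; last exact: continuous_expR.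
  by apply: cvgM; [exact: cvg_id | exact: cvg_cst].
have : \forall s \near a^'-, [/\ 0 < s, s < a & \sum_(i | P i) F i `^ s < 1].
  near=> s; split; near: s; [exact: nbhs_left_gt | exact: nbhs_left_lt |].
  exact: (cvgr_lt _ (cvg_at_left_filter Fcvg)).
exact: filter_ex.
Unshelve. all: by end_near. Qed.

(** * Hausdorff measure of self-covered sets *)

Section HausdorffBounds.
Context {R : realType} {d : nat}.
Implicit Types (A U : set 'rV[R]_d) (s delta e : R).

Lemma eucl_diam_le U e : (forall x y, U x -> U y -> eucl_dist x y <= e) ->
  (eucl_diam U <= e%:E)%E.
Proof.
by move=> Ue; apply: ge_ereal_sup => _ [x Ux [y Uy <-]]; rewrite lee_fin Ue.
Qed.

Lemma diam_pow_ge0 s U : (0 <= diam_pow s U)%E.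
Proof. by rewrite /diam_pow; case: ifP => // _; exact: poweR_ge0. Qed.

Lemma diam_pow_le s U e : 0 <= s -> 0 <= e -> (eucl_diam U <= e%:E)%E ->
  (diam_pow s U <= (e `^ s)%:E)%E.
Proof.
move=> s0 e0 Ue; rewrite /diam_pow; case: ifPn => [_|/set0P[x Ux]].
  by rewrite lee_fin powR_ge0.
have U0 : (0 <= eucl_diam U)%E.
  by apply: ereal_sup_ubound; exists x => //; exists x; rewrite ?eucl_distxx.
rewrite -poweR_EFin; apply: gt0_ler_poweR => //.
  by rewrite in_itv/= U0 leey.
by rewrite in_itv/= lee_fin e0 leey.
Qed.

(** Bounds [e i] on the diameters replace the diameters themselves, so that the
sums to be estimated are finite sums of real numbers. *)
Lemma hausdorff_premeasure_finite_cover {I : finType} (U : I -> set 'rV[R]_d)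
    (e : I -> R) A s delta :
  0 <= s -> (forall i, 0 <= e i <= delta) ->
  (forall i, (eucl_diam (U i) <= (e i)%:E)%E) -> A `<=` \bigcup_i U i ->
  (hausdorff_premeasure s delta A <= (\sum_i e i `^ s)%:E)%E.
Proof.
move=> s0 ed Ue AU; pose V k := nth set0 [seq U i | i <- enum I] k.
have Vlt (k : 'I_#|I|) : V k = U (enum_val k).
  by rewrite /V (nth_map (enum_val k)) -?cardE// -enum_val_nth.
(* The empty sets that pad the enumeration contribute 0 to the series. *)
have Vge k : (#|I| <= k)%N -> V k = set0.
  by move=> kI; rewrite /V nth_default// size_map -cardE.
have : (hausdorff_premeasure s delta A <= \sum_(0 <= k <oo) diam_pow s (V k))%E.
  apply: ereal_inf_lbound; exists V => //; split=> [k|x /AU[i _ Uix]].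
    have [kI|/Vge->] := ltnP k #|I|.
      rewrite (Vlt (Ordinal kI)); apply: le_trans (Ue _) _.
      by rewrite lee_fin; have /andP[] := ed (enum_val (Ordinal kI)).
    by apply: ge_ereal_sup => ? [? []].
  by exists (enum_rank i) => //; rewrite Vlt enum_rankK.
move/le_trans; apply.
rewrite (@nneseries_split _ _ 0 #|I|); last by move=> *; exact: diam_pow_ge0.
rewrite eseries0 ?adde0 ?add0n; last first.
  by move=> i /Vge Vi _; rewrite Vi /diam_pow eqxx.
rewrite -sumEFin big_mkord.
rewrite [leRHS](reindex (fun k : 'I_#|I| => enum_val k))/=; last first.
  exact/onW_bij/enum_val_bij.
apply: lee_sum => k _; rewrite Vlt.
by apply: diam_pow_le => //; have /andP[] := ed (enum_val k).
Qed.

Lemma hausdorff_premeasure_ge0 s delta A :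
  (0 <= hausdorff_premeasure s delta A)%E.
Proof.
apply: le_ereal_inf_tmp => _ [U _ <-]; apply: nneseries_ge0 => *.
exact: diam_pow_ge0.
Qed.

(** Moran's upper bound.  The copies of [A] along the words of length [k] cover
[A]; the sum of the [s]-th powers of their diameters is at most
[D `^ s * (\sum_i r i `^ s) ^+ k], where [D] bounds the diameter of [A].  As [k]
grows this tends to 0, and so do the diameters. *)
Lemma self_covered_hausdorff_measure0 {N : nat}
    (w : 'I_N -> 'rV[R]_d -> 'rV[R]_d) (r : 'I_N -> R) A s :
  (forall i, contracting_similitude (r i) (w i)) -> compact A ->
  A `<=` \bigcup_(i in setT) (w i @` A) ->
  0 <= s -> \sum_i r i `^ s < 1 -> hausdorff_measure s A = 0%E.
Proof.
move=> w_sim /compact_eucl_bounded[D D0 AD] Aw s0 rs.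
have r0 i : 0 <= r i by have [/ltW] := w_sim i.
have wr0 (t : seq 'I_N) : 0 <= word_ratio r t.
  by apply/ltW; exact: (word_ratio_gt0 w_sim).
have sum_cvg0 : (fun k => D `^ s * (\sum_i r i `^ s) ^+ k) @ \oo --> (0 : R).
  have c0 : 0 <= \sum_i r i `^ s by apply: sumr_ge0 => i _; exact: powR_ge0.
  rewrite -[X in _ --> X](mulr0 (D `^ s)); apply: cvgM; first exact: cvg_cst.
  by apply: cvg_expr; rewrite ger0_norm.
have premeasure_le0 delta : 0 < delta ->
    (hausdorff_premeasure s delta A <= 0)%E.
  move=> delta0; apply/lee_addgt0Pr => e e0; rewrite add0e.
  have : \forall k \near \oo,
      D `^ s * (\sum_i r i `^ s) ^+ k < e /\
      forall t : k.-tuple 'I_N, word_ratio r t < delta / (D + 1).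
    near=> k; split; near: k; first exact: (cvgr_lt _ sum_cvg0).
    (* Dividing by [D + 1] rather than [D] covers the case [D = 0]. *)
    by apply: (word_ratio_small w_sim); rewrite divr_gt0// ltr_wpDl.
  move=> /filter_ex[k [/ltW ke kdelta]].
  have := @hausdorff_premeasure_finite_cover _
    (fun t : k.-tuple 'I_N => word_map w t @` A)
    (fun t => D * word_ratio r t) A s delta s0.
  move=> /(_ _ _ (word_cover k Aw))/le_trans; apply.
  - move=> t; rewrite mulr_ge0//=; have := kdelta t.
    rewrite ltr_pdivlMr ?ltr_wpDl// => /ltW; apply: le_trans.
    by rewrite mulrC ler_wpM2l// ?lerDl.
  - move=> t; apply: eucl_diam_le => _ _ [x Ax <-] [y Ay <-].
    by rewrite (word_map_dist w_sim) mulrC ler_wpM2r ?AD.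
  - rewrite lee_fin (le_trans _ ke)// -sum_tuple_prod mulr_sumr.
    by apply: ler_sum => t _; rewrite powRM// powR_prod.
apply/eqP; rewrite eq_le; apply/andP; split.
  by apply: ge_ereal_sup => _ [delta delta0 <-]; exact: premeasure_le0.
apply: le_trans (hausdorff_premeasure_ge0 s 1 A) _.
by apply: ereal_sup_ubound; exists 1 => /=.
Unshelve. all: by end_near. Qed.

Lemma hausdorff_dim_le s A : 0 <= s -> hausdorff_measure s A = 0%E ->
  (hausdorff_dim A <= s%:E)%E.
Proof. by move=> s0 As; apply: ereal_inf_lbound; exists s. Qed.

End HausdorffBounds.

(** * Separation on the attractor *)

(** A finite union of closed sets without relative interior in [A] has none
either: each closed set is removed in turn from the open set [V]. *)
Lemma avoid_closed_family {T : topologicalType} {I : eqType} (A : set T)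
    (C : I -> set T) (l : seq I) (V : set T) :
  (forall i, closed (C i)) ->
  (forall i U, i \in l -> open U -> U `&` A !=set0 -> ~ (U `&` A `<=` C i)) ->
  open V -> V `&` A !=set0 ->
  exists x, [/\ V x, A x & forall i, i \in l -> ~ C i x].
Proof.
move=> Ccl; elim: l V => [|i l IH] V nCA Vo VA.
  by have [x [Vx Ax]] := VA; exists x.
have [|||x [[Vx nCx] Ax xl]] := IH (V `&` ~` C i).
- by move=> j U jl; apply: nCA; rewrite inE jl orbT.
- by apply: openI => //; exact: closed_openC.
- have /existsNP[x /not_implyP[[Vx Ax] nCx]] := nCA i V (mem_head _ _) Vo VA.
  by exists x.
- exists x; split=> // j; rewrite inE => /orP[/eqP->//|]; exact: xl.
Qed.

Section Attractor.
Context {R : realType} {d N : nat}.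
Variables (w : 'I_N -> 'rV[R]_d -> 'rV[R]_d) (r : 'I_N -> R) (A : set 'rV[R]_d).
Hypothesis w_sim : forall i, contracting_similitude (r i) (w i).
Hypothesis A_attr : is_attractor w A.

Let Ac : compact A. Proof. by have [] := A_attr. Qed.

Let A_cover : A `<=` \bigcup_(i in setT) (w i @` A).
Proof. by have [_ _ {1}->] := A_attr. Qed.

Let A_stable i : w i @` A `<=` A.
Proof. by have [_ _ {2}->] := A_attr => x wx; exists i. Qed.

Lemma word_image_closed s : closed (word_map w s @` A).
Proof.
apply: compact_closed; first exact: norm_hausdorff.
apply: continuous_compact => //.
exact/continuous_subspaceT/(word_map_continuous w_sim).
Qed.

(** Every point of [A] lies in copies of [A] of arbitrarily small diameter. *)
Lemma open_contains_word_image V : open V -> V `&` A !=set0 ->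
  exists s, word_map w s @` A `<=` V.
Proof.
move=> Vo [a [Va Aa]]; have [e e0 eV] := open_contains_eucl_ball Vo Va.
have [D D0 AD] := compact_eucl_bounded Ac.
have /(word_ratio_small w_sim)/filter_ex[k ke] : 0 < e / (D + 1).
  by rewrite divr_gt0// ltr_wpDl.
have [t _ [b Ab ba]] := word_cover k A_cover Aa.
exists t => _ [x Ax <-]; apply: eV; rewrite -ba (word_map_dist w_sim).
have := ke t; rewrite ltr_pdivlMr ?ltr_wpDl//; apply: le_lt_trans.
apply: ler_wpM2l; first by apply/ltW; exact: (word_ratio_gt0 w_sim).
by rewrite (le_trans (AD _ _ _ _))// lerDl.
Qed.

Variable alpha : R.
Hypothesis alpha_dim : is_similarity_dim r alpha.

(** The words other than [c] form a system that still covers [A] and whose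
[alpha]-sum is [1 - word_ratio c `^ alpha], and the sum stays below [1] for some
smaller exponent. *)
Lemma redundant_word_dim_lt m (c : m.-tuple 'I_N) : (0 < m)%N ->
  A `<=` \bigcup_(t in [set t : m.-tuple 'I_N | t <> c]) (word_map w t @` A) ->
  (hausdorff_dim A < alpha%:E)%E.
Proof.
move=> m0 Ac_cover; have [alpha0 sum1] := alpha_dim.
have r0 i : 0 <= r i by have [/ltW] := w_sim i.
have total : \sum_(t : m.-tuple 'I_N) word_ratio r t `^ alpha = 1.
  under eq_bigr do rewrite powR_prod//.
  by rewrite sum_tuple_prod sum1 expr1n.
pose P := [pred t : m.-tuple 'I_N | t != c].
have [||s [s0 s_alpha sum_lt1]] :=
    @sum_powR_lt1 _ _ P (fun t : m.-tuple 'I_N => word_ratio r t) alpha alpha0.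
- by move=> t; exact: (word_ratio_gt0 w_sim).
- rewrite -total [ltRHS](bigD1 c)//= ltrDr powR_gt0//.
  exact: (word_ratio_gt0 w_sim).
have s_lt : (s%:E < alpha%:E)%E by rewrite lte_fin.
apply: le_lt_trans s_lt; apply: hausdorff_dim_le; first exact: ltW.
apply: (@self_covered_hausdorff_measure0 _ _ #|P|
  (fun i => word_map w (enum_val i))
  (fun i => word_ratio r (enum_val i))) => //.
- by move=> i; apply: word_map_similitude => //; rewrite size_tuple.
- move=> x /Ac_cover[t /= /eqP tc wt].
  by exists (enum_rank_in (A := P) tc t) => //; rewrite enum_rankK_in.
- exact: ltW.
- by rewrite -(big_enum_val (A := P) (fun t => word_ratio r t `^ s)).
Qed.

Hypothesis dim_eq : hausdorff_dim A = alpha%:E.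

(** Otherwise the copy of [A] along [i ++ s] is covered by the copies along the
words [j ++ v] with [v] as long as [s].  All of them differ from [i ++ s], since
[i] and [j] are distinct of the same length, so [i ++ s] would be redundant. *)
Lemma word_image_not_sub n (i j : n.-tuple 'I_N) s : (0 < n)%N -> i <> j ->
  ~ (word_map w (i ++ s) @` A `<=` word_map w j @` A).
Proof.
move=> n0 ij sub; suff : (hausdorff_dim A < alpha%:E)%E by rewrite dim_eq ltxx.
pose c := [tuple of i ++ in_tuple s].
apply: (@redundant_word_dim_lt _ c); first by rewrite addn_gt0 n0.
move=> x Ax.
have [t _ wtx] := word_cover (n + size s) A_cover Ax.
have [tc|tc] := eqVneq t c; last by exists t => //; exact/eqP.
have /sub[y Ay <-] : (word_map w (i ++ s) @` A) x.
  by move: wtx; rewrite tc.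
have [v _ [z Az <-]] := word_cover (size s) A_cover Ay.
exists [tuple of j ++ v]; last by exists z => //=; rewrite word_map_cat.
move=> /(congr1 val)/= /eqP; rewrite eqseq_cat ?size_tuple//.
move=> /andP[/eqP ji _].
by apply: ij; apply: val_inj.
Qed.

Lemma separated_point n V : (0 < n)%N -> open V -> V `&` A !=set0 ->
  exists x, [/\ V x, A x & forall i j : n.-tuple 'I_N, i <> j ->
    ~ (word_map w j @` A) (word_map w i x)].
Proof.
move=> n0 Vo VA.
pose C (p : n.-tuple 'I_N * n.-tuple 'I_N) :=
  word_map w p.1 @^-1` (word_map w p.2 @` A).
pose l := [seq p <- enum {: n.-tuple 'I_N * n.-tuple 'I_N} | p.1 != p.2].
have [|p U|x [Vx Ax xl]] := @avoid_closed_family _ _ A C l V _ _ Vo VA.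
- move=> p; apply: closed_comp => [x _|]; last exact: word_image_closed.
  exact: (word_map_continuous w_sim).
- rewrite mem_filter => /andP[/eqP p12 _] Uo UA UC.
  have [s sU] := open_contains_word_image Uo UA.
  have := @word_image_not_sub n p.1 p.2 s n0 p12; apply=> _ [a Aa <-].
  rewrite word_map_cat; apply: UC; split; first by apply: sU; exists a.
  by apply: (word_map_sub A_stable); exists a.
- exists x; split=> // i j ij; apply: (xl (i, j)).
  by rewrite mem_filter mem_enum/= andbT; exact/eqP.
Qed.

(** The factor 2 matches the constant of [eucl_dist_max2]: it keeps apart the
images of two such balls under distinct words. *)
Definition separation_radius n (x : 'rV[R]_d) (e : R) :=
  0 < e /\ forall i j : n.-tuple 'I_N, i <> j -> forall y, A y ->
    2 * (word_ratio r i * e) <= eucl_dist (word_map w i x) (word_map w j y).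

(** [w_i x] has positive distance to each of the finitely many closed sets
[w_j A] with [j <> i]. *)
Lemma separation_radius_exists n x :
  (forall i j : n.-tuple 'I_N, i <> j ->
    ~ (word_map w j @` A) (word_map w i x)) ->
  exists e, separation_radius n x e.
Proof.
move=> xsep.
suff : \forall e \near 0^'+,
    forall i j : n.-tuple 'I_N, i <> j -> forall y, A y ->
    2 * (word_ratio r i * e) <= eucl_dist (word_map w i x) (word_map w j y).
  move=> near_sep.
  have : \forall e \near 0^'+, separation_radius n x e.
    by near=> e; split; near: e; [exact: nbhs_right_gt | exact: near_sep].
  exact: (@filter_ex _ _ (at_right_proper_filter 0)).
apply: filter_forall => i; apply: filter_forall => j.
have [->|/eqP ij] := eqVneq i j; first by apply: nearW => e.
have [e0 e0_gt0 ball_e0] := open_contains_eucl_ball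
  (closed_openC (word_image_closed (s := j))) (xsep _ _ ij).
have ri : 0 < 2 * word_ratio r i.
  by rewrite mulr_gt0//; exact: (word_ratio_gt0 w_sim).
near=> e => _ y Ay; rewrite mulrA -ler_pdivlMl//.
have e_lt : e < e0 / (2 * word_ratio r i).
  by near: e; apply: nbhs_right_lt; rewrite divr_gt0.
apply: le_trans (ltW e_lt) _; rewrite mulrC ler_pM2l ?invr_gt0//.
rewrite leNgt eucl_dist_sym; apply/negP => /ball_e0; apply.
by exists y.
Unshelve. all: by end_near. Qed.

End Attractor.

Theorem proposition7 (R : realType) (d N : nat)
    (w : 'I_N -> 'rV[R]_d -> 'rV[R]_d) (r : 'I_N -> R)
    (A : set 'rV[R]_d) (alpha : R)
    (d_ge1 : (1 <= d)%N) (N_ge2 : (2 <= N)%N)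
    (w_sim : forall i : 'I_N, contracting_similitude (r i) (w i))
    (A_attr : is_attractor w A)
    (alpha_dim : is_similarity_dim r alpha)
    (dim_eq : hausdorff_dim A = alpha%:E) :
  strong_markov_property w A.
Proof.
have [_ Ac _] := A_attr.
move=> n n0.
pose balls := [set p : 'rV[R]_d * R |
  A p.1 /\ separation_radius w r A n p.1 p.2].
exists (\bigcup_(p in balls) [set z | eucl_dist z p.1 < p.2]); split.
- by apply: bigcup_open => p _; exact: open_eucl_ball.
- rewrite eqEsubset; split.
    have /closure_id {2}-> : closed A.
      by apply: compact_closed => //; exact: norm_hausdorff.
    by apply: closure_subset; exact: subIsetr.
  move=> x Ax B /nbhs_interior; rewrite nbhsE => -[V [Vo Vx] VB].
  have [|y [Vy Ay ysep]] :=
    separated_point w_sim A_attr alpha_dim dim_eq n0 Vo; first by exists x.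
  have [e ye] := separation_radius_exists w_sim A_attr ysep.
  exists y; split; last by apply: interior_subset; exact: VB.
  split=> //; exists (y, e) => //=.
  by rewrite eucl_distxx; case: ye.
- move=> i j ij; rewrite -subset0.
  move=> z [[x' [[x e] [/= Ax [e0 xe]] /= xx'] wx'z]
            [y' [[y f] [/= Ay [f0 yf]] /= yy'] wy'z]].
  have /= xD := xe _ _ ij _ Ay; have /= := yf _ _ (nesym ij) _ Ax.
  move: xD {xe yf}.
  rewrite [in X in _ -> X](eucl_dist_sym (word_map w j y)).
  set D := eucl_dist _ _ => xD yD.
  have xz : eucl_dist (word_map w i x) z < word_ratio r i * e.
    rewrite -wx'z (word_map_dist w_sim) eucl_dist_sym.
    by rewrite ltr_pM2l//; exact: (word_ratio_gt0 w_sim).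
  have zy : eucl_dist z (word_map w j y) < word_ratio r j * f.
    rewrite -wy'z (word_map_dist w_sim).
    by rewrite ltr_pM2l//; exact: (word_ratio_gt0 w_sim).
  have : D <= 2 * Num.max (eucl_dist (word_map w i x) z)
                          (eucl_dist z (word_map w j y)).
    exact: eucl_dist_max2.
  move: xD yD xz zy; clear => xD yD xz zy.
  by rewrite maxEle; case: ifP => _; lra.
Qed.
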